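(* Let $(\mathcal{C},\mathcal{S})$ be a category with covers, and let $\mathcal{R}$ be an equivalence relation on $\mathrm{Mor}_{\mathcal{C}}(c,c')$ for each $c,c'\in\mathcal{C}$ which preserves composition. Let $f:X\to Y$ and $f':X'\to Y$ be morphisms in $\mathcal{C}$, and assume there exists a morphism $\psi:X\to X'$ with $(f'\circ\psi)\,\mathcal{R}\,f$. Then $$\mathcal{R}\text{-}\mathrm{sec}(f)\geq \mathcal{R}\text{-}\mathrm{sec}(f')\quad\text{and}\quad \mathcal{R}\text{-}\mathrm{msec}(f)\geq \mathcal{R}\text{-}\mathrm{msec}(f').$$ In particular, if $f$ and $f'$ are $\mathcal{R}$-fibrewise equivalent, then $$\mathcal{R}\text{-}\mathrm{sec}(f)= \mathcal{R}\text{-}\mathrm{sec}(f')\quad\text{and}\quad \mathcal{R}\text{-}\mathrm{msec}(f)= \mathcal{R}\text{-}\mathrm{msec}(f').$$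
   Context: Sieves and covers: for a category $\mathcal{C}$ and an object $C$, the overcategory $\mathcal{C}_{|C}$ has as objects the morphisms with codomain $C$. A sieve on $C$ is a full subcategory $S\subset\mathcal{C}_{|C}$ (i.e. a class of morphisms with codomain $C$) such that $f\in S$ implies $f\circ g\in S$ for every $g$ with $\mathrm{codom}(g)=\mathrm{dom}(f)$. For a family $\{f_i:C_i\to C\}_{i\in I}$, the sieve generated by it, $\mathcal{C}^{(0)}_{|C}\{f_i:C_i\to C\}_{i\in I}$, consists of all $g:D\to C$ that factor as $D\to C_i\xrightarrow{f_i}C$ for some $i\in I$. A topology $\mathcal{S}$ on $\mathcal{C}$ assigns to each object $C$ a collection of sieves on $C$, called covering sieves (no axioms are required); $(\mathcal{C},\mathcal{S})$ is then called a category with covers. A family $\{f_i:C_i\to C\}_{i\in I}$ is a covering for $C$ if it generates a covering sieve on $C$. The relation $\mathcal{R}$ preserves composition if $f\,\mathcal{R}\,h$ in $\mathrm{Mor}_{\mathcal{C}}(c,c')$ and $f'\,\mathcal{R}\,h'$ in $\mathrm{Mor}_{\mathcal{C}}(c'',c)$ imply $(f\circ f')\,\mathcal{R}\,(h\circ h')$. Given $f:X\to Y$ and $g:Z\to Y$, an $\mathcal{R}$-$g$-section of $f$ is a morphism $s:Z\to X$ with $(f\circ s)\,\mathcal{R}\,g$. The $\mathcal{R}$-sectional number $\mathcal{R}\text{-}\mathrm{sec}(f)$ is the least integer $m\ge 1$ such that there is a covering $\{g_j:Y_j\to Y\}_{j=1}^m$ for $Y$ such that $f$ admits an $\mathcal{R}$-$g_j$-section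 for each $j$; the $\mathcal{R}$-mono sectional number $\mathcal{R}\text{-}\mathrm{msec}(f)$ is defined in the same way with the additional requirement that each $g_j$ is a monomorphism. Each is $\infty$ if no such $m$ exists. Morphisms $f:X\to Y$ and $f':X'\to Y$ are $\mathcal{R}$-fibrewise equivalent if there are morphisms $\psi:X\to X'$ and $\varphi:X'\to X$ with $(f'\circ\psi)\,\mathcal{R}\,f$ and $(f\circ\varphi)\,\mathcal{R}\,f'$. *)

(* Defs.v *)
From mathcomp Require Import all_boot all_order all_algebra.
From mathcomp Require Import boolp constructive_ereal.

Set Implicit Arguments.
Unset Strict Implicit.
Unset Printing Implicit Defensive.

Record category := Category {
  obj :> Type;
  mor : obj -> obj -> Type;
  idmor : forall a, mor a a;
  mcomp : forall a b c, mor b c -> mor a b -> mor a c;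
  mcomp_idl : forall a b (f : mor a b), mcomp (idmor b) f = f;
  mcomp_idr : forall a b (f : mor a b), mcomp f (idmor a) = f;
  mcomp_assoc : forall a b c d (h : mor c d) (g : mor b c) (f : mor a b),
    mcomp h (mcomp g f) = mcomp (mcomp h g) f
}.

Arguments idmor {_} _.
Arguments mcomp {_ _ _ _} _ _.

Declare Scope cat_scope.
Delimit Scope cat_scope with cat.
Notation "g '\oc' f" := (mcomp g f)
  (at level 50, left associativity, format "g  '\oc'  f") : cat_scope.
Local Open Scope cat_scope.

Definition monomorphism (C : category) (a b : C) (f : mor a b) : Prop :=
  forall (d : C) (u v : mor d a), f \oc u = f \oc v -> u = v.

(* A full subcategory of the overcategory of [c] is determined by its class of
   objects, that is, by a class of morphisms with codomain [c]. *)
Record sieve (C : category) (c : C) := Sieve {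
  in_sieve :> forall d : C, mor d c -> Prop;
  sieve_closed : forall (d e : C) (f : mor d c) (g : mor e d),
    in_sieve f -> in_sieve (f \oc g)
}.

Section GeneratedSieve.
Variables (C : category) (c : C) (I : Type).
Variables (dom : I -> C) (f : forall i, mor (dom i) c).

Definition factors_through_family (d : C) (g : mor d c) : Prop :=
  exists (i : I) (h : mor d (dom i)), g = f i \oc h.

Lemma factors_through_family_closed (d e : C) (g : mor d c) (h : mor e d) :
  factors_through_family g -> factors_through_family (g \oc h).
Proof.
by case=> [i [k ->]]; exists i, (k \oc h); rewrite mcomp_assoc.
Qed.

Definition generated_sieve : sieve c := Sieve factors_through_family_closed.

End GeneratedSieve.

(* The collections of covering sieves; no axioms are required. *)
Definition topology (C : category) := forall c : C, sieve c -> Prop.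

Definition covering (C : category) (S : topology C) (c : C) (I : Type)
    (dom : I -> C) (f : forall i, mor (dom i) c) : Prop :=
  S c (generated_sieve f).

Definition mor_relation (C : category) :=
  forall c c' : C, mor c c' -> mor c c' -> Prop.

Definition preserves_composition (C : category) (R : mor_relation C) : Prop :=
  forall (c c' c'' : C) (f h : mor c c') (f' h' : mor c'' c),
    R c c' f h -> R c'' c f' h' -> R c'' c' (f \oc f') (h \oc h').

Definition is_section (C : category) (R : mor_relation C) (X Y Z : C)
    (f : mor X Y) (g : mor Z Y) (s : mor Z X) : Prop :=
  R Z Y (f \oc s) g.

(* The least natural number satisfying [P], or [+oo] if there is none. The
   value is taken in [\bar int] because the order on [\bar T] needs a
   [numDomainType]. *)
Definition least (P : nat -> Prop) : \bar int :=
  match pselect (exists m, `[< P m >]) with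
  | left exP => EFin (Posz (ex_minn exP))
  | right _ => (+oo)%E
  end.

Section SectionalNumbers.
Variables (C : category) (S : topology C) (R : mor_relation C).
Variables (X Y : C) (f : mor X Y).

Definition sec : \bar int :=
  least (fun m => (1 <= m)%N /\
    exists (dom : 'I_m -> C) (g : forall j, mor (dom j) Y),
      covering S g /\
      forall j, exists s : mor (dom j) X, is_section R f (g j) s).

Definition msec : \bar int :=
  least (fun m => (1 <= m)%N /\
    exists (dom : 'I_m -> C) (g : forall j, mor (dom j) Y),
      [/\ covering S g,
          forall j, monomorphism (g j) &
          forall j, exists s : mor (dom j) X, is_section R f (g j) s]).

End SectionalNumbers.

Definition fibrewise_equivalent (C : category) (R : mor_relation C)
    (X X' Y : C) (f : mor X Y) (f' : mor X' Y) : Prop :=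
  exists (psi : mor X X') (phi : mor X' X),
    R X Y (f' \oc psi) f /\ R X' Y (f \oc phi) f'.

(* Main.v *)
(** If [s] is an R-g-section of [f], then [psi \oc s] is an R-g-section of [f'].
Hence every covering that bounds a sectional number of [f] also bounds that of
[f'], and the least such bound can only decrease. *)

Require Import Defs.
From mathcomp Require Import all_boot all_order all_algebra constructive_ereal.
From mathcomp Require Import boolp.

(** The minimum for [P] is itself a candidate for [Q], so the minimum for [Q] cannot exceed it. *)
Lemma least_anti (P Q : nat -> Prop) :
  (forall m, P m -> Q m) -> (least Q <= least P)%E.
Proof.
(* If nothing satisfies [Q], nothing satisfies [P] either, and both values are [+oo]. *)
move=> PQ; rewrite /least; case: pselect => [exQ|nQ]; last first.
  case: pselect => // exP; case: nQ.
  by case: exP => m /asboolP /PQ Qm; exists m; apply/asboolP.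
case: pselect => [exP|_]; last exact: leey.
rewrite lee_fin lez_nat; case: (ex_minnP exP) => m /asboolP /PQ Qm _.
by case: (ex_minnP exQ) => n _; apply; apply/asboolP.
Qed.

Section FibrewiseMorphism.
Variables (C : category) (S : topology C) (R : mor_relation C).
Hypothesis R_equiv : forall c c' : C, RelationClasses.Equivalence (R c c').
Hypothesis R_comp : preserves_composition R.
Variables (X X' Y : C) (f : mor X Y) (f' : mor X' Y) (psi : mor X X').
Hypothesis psi_fibrewise : R X Y (f' \oc psi)%cat f.

Lemma is_section_comp (Z : C) (g : mor Z Y) (s : mor Z X) :
  is_section R f g s -> is_section R f' g (psi \oc s)%cat.
Proof.
rewrite /is_section mcomp_assoc => fsg.
have [_ _ R_trans] := R_equiv Z Y; have [R_refl _ _] := R_equiv Z X.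
(* Composing [psi_fibrewise] with [s] related to itself relates [(f' \oc psi) \oc s] to [f \oc s],
   which [fsg] relates to [g]. *)
exact: R_trans (R_comp _ _ _ _ _ _ _ psi_fibrewise (R_refl s)) fsg.
Qed.

Lemma sec_fibrewise_le : (sec S R f' <= sec S R f)%E.
Proof.
apply: least_anti => m [m_gt0 [dom [g [gcov gsec]]]].
split=> //; exists dom, g; split=> // j.
by have [s /is_section_comp] := gsec j; exists (psi \oc s)%cat.
Qed.

Lemma msec_fibrewise_le : (msec S R f' <= msec S R f)%E.
Proof.
apply: least_anti => m [m_gt0 [dom [g [gcov gmono gsec]]]].
(* The family [g] is kept, so its members remain monomorphisms; only the sections change. *)
split=> //; exists dom, g; split=> // j.
by have [s /is_section_comp] := gsec j; exists (psi \oc s)%cat.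
Qed.

End FibrewiseMorphism.

Theorem theorem3p23 (C : category) (S : topology C) (R : mor_relation C)
    (R_equiv : forall c c' : C, RelationClasses.Equivalence (R c c'))
    (R_comp : preserves_composition R)
    (X X' Y : C) (f : mor X Y) (f' : mor X' Y) :
  ((exists psi : mor X X', R X Y (f' \oc psi)%cat f) ->
     (sec S R f >= sec S R f')%E /\ (msec S R f >= msec S R f')%E) /\
  (fibrewise_equivalent R f f' ->
     sec S R f = sec S R f' /\ msec S R f = msec S R f').
Proof.
split=> [[psi fpsi]|[psi [phi [fpsi fphi]]]].
  by split; [apply: sec_fibrewise_le fpsi | apply: msec_fibrewise_le fpsi].
(* Antisymmetry: [phi] plays the part of [psi] with [f] and [f'] exchanged, which gives the reverse
   inequalities. *)
split; apply: Order.POrderTheory.le_anti; apply/andP; split.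
- exact: sec_fibrewise_le fphi.
- exact: sec_fibrewise_le fpsi.
- exact: msec_fibrewise_le fphi.
- exact: msec_fibrewise_le fpsi.
Qed.
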